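(* The multiset spectrum of the operator $L_\delta(c_b^\delta)$ of a block idempotent in $\mathbb A^\delta(G_2(m))$ is completely determined (for given $m$) by the single integer $$n^{\delta}_{-1}(b)=|\{r\in R:\kappa_{ijkr}=-1\}|,\qquad \{i,j,k\}=\operatorname{supp}(b),\quad R=\Omega\setminus\{i,j,k\}.$$ Moreover, for every decoration $\delta$ of $G_2(m)$ (and every block $b$), $0\le n^{\delta}_{-1}(b)\le m-3$. Conversely, for every block $b\in\mathcal B$ and every integer $0\le n\le m-3$ there exists a decoration $\delta$ of $G_2(m)$ for which $n^{\delta}_{-1}(b)=n$.
   Context: Let $K$ be a field of characteristic $0$, $m\ge 3$ an integer and $\Omega=\{1,\dots,m\}$. The Grassmannian geometry $G_2(m)$ has point set $\mathcal P=\binom{\Omega}{2}$ (the point $\{i,j\}$ is written $ij$) and block set $\mathcal B$ consisting of the triples $b_{ijk}=\{ij,ik,jk\}$, one for each $3$-subset $\{i,j,k\}\subseteq\Omega$. The support of a block is $\operatorname{supp}(b)=\bigcup_{p\in b}p$, so $\operatorname{supp}(b_{ijk})=\{i,j,k\}$. A decoration is a map $\delta:\mathcal B\to\{\pm1\}$. The decorated incidence algebra $\mathbb A^\delta(G_2(m))$ is the commutative (nonassociative) $K$-algebra with basis $\{e_p:p\in\mathcal P\}$ and bilinear product $\circ_\delta$ given by $e_{ij}\circ_\delta e_{ik}=\delta(b_{ijk})e_{jk}$ for distinct $i,j,k\in\Omega$, and $e_p\circ_\delta e_q=0$ if $p=q$ or $p\cap q=\varnothing$. For a block $b$, the block idempotent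 is $c_b^\delta=\tfrac12\delta(b)\sum_{p\in b}e_p$, and $L_\delta(c):x\mapsto c\circ_\delta x$; its multiset spectrum is the multiset of eigenvalues with algebraic multiplicity. For a $4$-subset $\{i,j,k,r\}$ of $\Omega$, $\kappa_{ijkr}=\delta(b_{ijk})\delta(b_{ijr})\delta(b_{ikr})\delta(b_{jkr})$. *)

(* Defs.v *)
From HB Require Import structures.
From mathcomp Require Import all_boot all_order all_algebra.
From mathcomp Require Import finmap multiset.

Set Implicit Arguments.
Unset Strict Implicit.
Unset Printing Implicit Defensive.

Import Order.TTheory GRing.Theory Num.Theory.
Local Open Scope ring_scope.

(* The ground set Omega = {1, ..., m} is represented by 'I_m = {0, ..., m-1}. *)
Definition point (m : nat) := {p : {set 'I_m} | #|p| == 2%N}.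

(* b_ijk = {ij, ik, jk} is the set of all points contained in T = {i, j, k}. *)
Definition is_block (m : nat) (b : {set point m}) : bool :=
  [exists T : {set 'I_m}, (#|T| == 3%N) && (b == [set p : point m | val p \subset T])].

Definition block (m : nat) := {b : {set point m} | is_block b}.

Definition supp (m : nat) (b : block m) : {set 'I_m} :=
  \bigcup_(p in val b) val p.

Definition sign := {s : int | (s == 1) || (s == -1)}.

Definition decoration (m : nat) := block m -> sign.

(* kappa_ijkr for Q = {i, j, k, r}: the blocks with support in Q are exactly
   b_ijk, b_ijr, b_ikr and b_jkr (see kappaE). *)
Definition kappa (m : nat) (delta : decoration m) (Q : {set 'I_m}) : int :=
  \prod_(b : block m | supp b \subset Q) val (delta b).

Definition n_neg (m : nat) (delta : decoration m) (b : block m) : nat :=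
  #|[set r in ~: supp b | kappa delta (r |: supp b) == -1]|.

Section IncidenceAlgebra.
Variables (K : fieldType) (m : nat).

(* The carrier K^P; the product depends on the decoration. *)
Definition incalg := {ffun point m -> K^o}.
HB.instance Definition _ := Vector.on incalg.

Definition pt_elt (p : point m) : incalg := [ffun q => (q == p)%:R].

Variable delta : decoration m.

Definition dsign (b : block m) : K := (val (delta b))%:~R.

(* A block has exactly three points, so val b = {p, q, r} forces p, q, r to be
   pairwise distinct (see mul_basis and mul_basis0 for the usual rules). *)
Definition mul_basis_def (p q : point m) : incalg :=
  \sum_(b : block m) \sum_(r | val b == [set p; q; r]) dsign b *: pt_elt r.

Definition mul (x y : incalg) : incalg :=
  \sum_p \sum_q (x p * y q) *: mul_basis_def p q.

Fact mul_is_linear (x : incalg) : linear (mul x).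
Proof.
move=> a y z; rewrite /mul scaler_sumr -big_split; apply: eq_bigr => p _ /=.
rewrite scaler_sumr -big_split; apply: eq_bigr => q _ /=.
by rewrite !ffunE mulrDr scalerDl scalerA mulrCA.
Qed.
HB.instance Definition _ (x : incalg) :=
  GRing.isLinear.Build K incalg incalg _ (mul x) (mul_is_linear x).

Definition lmul (c : incalg) : 'End(incalg) := linfun (mul c).

Definition block_idem (b : block m) : incalg :=
  (2%:R^-1 * dsign b) *: \sum_(p in val b) pt_elt p.

End IncidenceAlgebra.

(* s is the multiset of eigenvalues of f with algebraic multiplicities, all of
   them lying in K.  The characteristic polynomial does not depend on the choice
   of the basis, and it determines s. *)
Definition is_spectrum (K : fieldType) (V : vectType K) (f : 'End(V))
    (s : {mset K}%mset) : Prop :=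
  char_poly (passmx.mxof (vbasis {:V}) (vbasis {:V}) f) = \prod_(a <- s) ('X - a%:P).

Lemma is_spectrum_inj (K : fieldType) (V : vectType K) (f : 'End(V))
    (s t : {mset K}%mset) :
  is_spectrum f s -> is_spectrum f t -> s = t.
Proof.
by rewrite /is_spectrum => -> /prod_XsubC_eq /eq_seq_msetP; rewrite !seq_mset_id.
Qed.

Section Facts.
Variable m : nat.

Lemma blockP (b : block m) :
  #|supp b| = 3%N /\ val b = [set p : point m | val p \subset supp b].
Proof.
case: b => b bP; rewrite /supp /=.
case/existsP: (bP) => T /andP[/eqP T3 /eqP bE].
suff -> : \bigcup_(p in b) val p = T by [].
apply/setP => i; apply/bigcupP/idP => [[p]|iT].
  by rewrite bE inE => /subsetP pT /pT.
have : (0 < #|T :\ i|)%N.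
  by have := cardsD1 i T; rewrite T3 iT => /(@addnI 1 2) <-.
case/card_gt0P => j; rewrite !inE => /andP[ji jT].
have c2 : #|[set i; j]| == 2%N by rewrite cards2 (eq_sym i) ji.
exists (Sub [set i; j] c2 : point m); last by rewrite /= !inE eqxx.
by rewrite bE inE /= subUset !sub1set iT jT.
Qed.

Lemma supp_inj : injective (@supp m).
Proof.
by move=> b c bc; apply: val_inj; rewrite (blockP b).2 (blockP c).2 bc.
Qed.

Lemma block_ex (T : {set 'I_m}) : #|T| = 3%N -> exists b : block m, supp b = T.
Proof.
move=> T3.
have bP : is_block [set p : point m | val p \subset T].
  by apply/existsP; exists T; rewrite T3 !eqxx.
exists (Sub _ bP : block m); set b := Sub _ _.
apply/eqP; rewrite eqEcard T3 (blockP b).1 leqnn andbT.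
by apply/bigcupsP => p; rewrite inE.
Qed.

Lemma kappaE (delta : decoration m) (i j k r : 'I_m)
    (bijk bijr bikr bjkr : block m) :
    uniq [:: i; j; k; r] ->
    supp bijk = [set i; j; k] -> supp bijr = [set i; j; r] ->
    supp bikr = [set i; k; r] -> supp bjkr = [set j; k; r] ->
  kappa delta [set i; j; k; r] =
  val (delta bijk) * val (delta bijr) * val (delta bikr) * val (delta bjkr).
Proof.
rewrite /= !inE !negb_or !andbT => /and3P[/and3P[ij ik ir] /andP[jk jr] kr].
have ij' : j != i by rewrite eq_sym.
have ik' : k != i by rewrite eq_sym.
have ir' : r != i by rewrite eq_sym.
have jk' : k != j by rewrite eq_sym.
have jr' : r != j by rewrite eq_sym.
have kr' : r != k by rewrite eq_sym.
have N := (negPf ij, negPf ik, negPf ir, negPf jk, negPf jr, negPf kr).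
have N' := (negPf ij', negPf ik', negPf ir', negPf jk', negPf jr', negPf kr').
move=> s1 s2 s3 s4; rewrite /kappa.
have u : uniq [:: bijk; bijr; bikr; bjkr].
  have D (x : 'I_m) (b c : block m) : (x \in supp b) != (x \in supp c) -> b != c.
    by apply: contraNneq => ->.
  rewrite /= !inE !negb_or !andbT -!andbA.
  apply/and5P; split; [apply: (D r)|apply: (D r)|apply: (D r)|apply: (D k)|].
  all: rewrite ?(s1, s2, s3, s4) ?inE ?eqxx ?orbT ?N ?N' //.
  by apply/andP; split; [apply: (D k)|apply: (D i)];
     rewrite ?(s1, s2, s3, s4) !inE !eqxx ?orbT ?N ?N'.
rewrite (eq_bigl [in [:: bijk; bijr; bikr; bjkr]]) => [|b].
  by rewrite -big_uniq //= !big_cons big_nil mulr1 !mulrA.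
rewrite !inE; apply/idP/idP => [sQ|]; last first.
  by case/or4P => /eqP->; rewrite ?(s1, s2, s3, s4); apply/subsetP => x;
     rewrite !inE => /orP[/orP[]|] ->; rewrite ?orbT.
have Q4 : #|[set i; j; k; r]| = 4%N.
  by rewrite -!setUA !cardsU1 cards1 !inE !N.
have [b3 _] := blockP b.
have : ([set i; j; k; r] :\: supp b) != set0.
  by rewrite -card_gt0 cardsDS // Q4 b3.
case/set0Pn => x /setDP[xQ xb].
have bE : supp b = [set i; j; k; r] :\ x.
  apply/eqP; rewrite eqEcard subsetD1 sQ xb /= b3.
  by have := cardsD1 x [set i; j; k; r]; rewrite Q4 xQ => /(@addnI 1 3) <-.
have E (T : {set 'I_m}) : #|T| = 3%N -> T \subset [set i; j; k; r] :\ x ->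
    T = supp b.
  by move=> T3 sT; apply/eqP; rewrite eqEcard bE sT -bE b3 T3.
have S (c : block m) : x \notin supp c -> supp c \subset [set i; j; k; r] ->
    b = c.
  move=> xc cQ; apply: supp_inj; apply/esym/E; first by case: (blockP c).
  by rewrite subsetD1 cQ xc.
move: xQ; rewrite !inE -!orbA => xQ.
case/or4P: xQ => /eqP xE; apply/or4P;
  [constructor 4|constructor 3|constructor 2|constructor 1].
all: apply/eqP/S; rewrite ?(s1, s2, s3, s4) ?xE ?inE ?N ?N' //.
all: by apply/subsetP => y; rewrite !inE => /orP[/orP[]|] ->; rewrite ?orbT.
Qed.

Variables (K : fieldType) (delta : decoration m).

Lemma mul_pt_elt (p q : point m) :
  mul delta (pt_elt K p) (pt_elt K q) = mul_basis_def K delta p q.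
Proof.
rewrite /mul (bigD1 p) //= (bigD1 q) //= !ffunE !eqxx mulr1 scale1r.
rewrite big1 => [|q' /negPf q'q]; last by rewrite !ffunE q'q mulr0 scale0r.
rewrite addr0 big1 ?addr0 // => p' /negPf p'p.
by rewrite big1 // => q' _; rewrite !ffunE p'p mul0r scale0r.
Qed.

Lemma card_block (b : block m) : #|val b| = 3%N.
Proof.
have [b3 ->] := blockP b.
rewrite -(card_imset _ val_inj) /=.
transitivity #|[set A : {set 'I_m} | A \subset supp b & #|A| == 2%N]|.
  congr #|pred_of_set _|; apply/setP => A.
  apply/imsetP/setIdP => [[p pb ->]|[Ab A2]].
    by rewrite inE in pb; split => //; apply: (valP p).
  by exists (Sub A A2 : point m); rewrite ?inE.
by rewrite cards_draws b3.
Qed.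

Lemma mem_block (b : block m) (p : point m) :
  (p \in val b) = (val p \subset supp b).
Proof. by rewrite (blockP b).2 inE. Qed.

Lemma mul_basis (i j k : 'I_m) (p q r : point m) (b : block m) :
    uniq [:: i; j; k] ->
    val p = [set i; j] -> val q = [set i; k] -> val r = [set j; k] ->
    supp b = [set i; j; k] ->
  mul delta (pt_elt K p) (pt_elt K q) = dsign K delta b *: pt_elt K r.
Proof.
move=> u pE qE rE bE; move: u.
rewrite /= !inE !negb_or !andbT => /andP[/andP[ij ik] jk].
have D (x : 'I_m) (y z : point m) : (x \in val y) != (x \in val z) -> y != z.
  by apply: contraNneq => ->.
have pq : p != q.
  by apply: (D j); rewrite pE qE !inE eqxx orbT eq_sym (eq_sym j) (negPf ij) (negPf jk).
have pr : p != r.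
  by apply: (D i); rewrite pE rE !inE eqxx (negPf ij) (negPf ik).
have qr : q != r.
  by apply: (D i); rewrite qE rE !inE eqxx (negPf ij) (negPf ik).
have valb : val b = [set p; q; r].
  apply/esym/eqP; rewrite eqEcard card_block -setUA !cardsU1 cards1 !inE.
  rewrite negb_or pq pr qr andbT !subUset !sub1set !mem_block bE pE qE rE.
  by rewrite !subUset !sub1set !inE !eqxx !orbT.
rewrite mul_pt_elt /mul_basis_def (bigD1 b) //= [X in _ + X]big1 ?addr0 => [|b' b'b].
  rewrite (big_pred1 r) // => r'; rewrite valb; apply/eqP/eqP => [E|-> //].
  have : r \in [set p; q; r'] by rewrite -E !inE eqxx !orbT.
  by rewrite !inE ![r == _]eq_sym (negPf pr) (negPf qr) /= => /eqP.
rewrite big_pred0 // => r'; apply: contraNF b'b => /eqP b'E.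
apply/eqP/esym/supp_inj/eqP; rewrite eqEcard !(blockP _).1 leqnn andbT bE.
have : (val p \subset supp b') && (val q \subset supp b').
  by rewrite -!mem_block (b'E : val b' = _) !inE !eqxx orbT.
rewrite pE qE => /andP[].
by rewrite !subUset !sub1set => /andP[-> ->] /andP[_ ->].
Qed.

Lemma mul_basis0 (p q : point m) :
  p = q \/ [disjoint val p & val q] -> mul delta (pt_elt K p) (pt_elt K q) = 0.
Proof.
move=> pq; rewrite mul_pt_elt /mul_basis_def big1 // => b _.
rewrite big_pred0 // => r; apply/negP => /eqP bE.
have b3 := card_block b; case: pq => [pq|pq].
  by move: b3; rewrite bE pq setUid cards2; case: (_ != _).
have : val p :|: val q \subset supp b.
  by rewrite subUset -!mem_block bE !inE !eqxx ?orbT.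
move/subset_leq_card; rewrite cardsU (blockP b).1.
rewrite (eqP (valP p)) (eqP (valP q)).
by move: pq; rewrite -setI_eq0 => /eqP ->; rewrite cards0.
Qed.

End Facts.

(* Main.v *)
Require Import Defs.
From mathcomp Require Import all_boot all_order all_algebra.
From mathcomp Require Import finmap multiset.
From mathcomp Require Import ring zify.

Set Implicit Arguments.
Unset Strict Implicit.
Unset Printing Implicit Defensive.

Import Order.TTheory GRing.Theory Num.Theory.
Local Open Scope ring_scope.

(* Left multiplication by the idempotent of b = b_ijk preserves the span of
   e_ij, e_ik, e_jk, the span of e_ir, e_jr, e_kr for every r outside {i, j, k},
   and kills every e_rs with r, s outside {i, j, k}.  On a three-dimensional
   summand its matrix is half a symmetric matrix with zero diagonal and entries
   u, v, w = +-1 off the diagonal, which a diagonal change of signs turns into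
   (k / 2) (J - 1) with J the all-ones matrix and k = u v w; its eigenvalues are
   k, -k/2, -k/2.  Here k = 1 on the first summand and k = kappa_ijkr on the
   others, so only the number of r with kappa_ijkr = -1 matters.
   To realize n, choose n elements r and put the sign -1 only on blocks avoiding
   i and meeting the chosen set: then kappa_ijkr = delta (b_jkr). *)

(** * Characteristic polynomials and eigenbases *)

Section EigenBasis.
Variables (K : fieldType) (V : vectType K).

(** The change-of-basis matrices [P] and [Q] conjugate one matrix into the other. Since [P *m Q] is
    the identity, the same conjugation over the polynomial ring relates the two characteristic
    matrices, and determinants agree. *)
Lemma char_poly_mxof_basis (e e' : (\dim {:V}).-tuple V) (f : 'End(V)) :
    basis_of {:V} e -> basis_of {:V} e' ->
  char_poly (passmx.mxof e e f) = char_poly (passmx.mxof e' e' f).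
Proof.
move=> eB e'B; pose P := passmx.mxof e e' \1%VF; pose Q := passmx.mxof e' e \1%VF.
have PQ : P *m Q = 1%:M.
  by rewrite /P /Q -passmx.mxof_comp // comp_lfun1l passmx.mxof1 ?(basis_free eB).
have fE : passmx.mxof e e f = P *m passmx.mxof e' e' f *m Q.
  by rewrite /P /Q -!passmx.mxof_comp // comp_lfun1l comp_lfun1r.
have PQX : map_mx polyC P *m map_mx polyC Q = 1%:M by rewrite -map_mxM PQ map_mx1.
rewrite /char_poly; have -> : char_poly_mx (passmx.mxof e e f) =
    map_mx polyC P *m char_poly_mx (passmx.mxof e' e' f) *m map_mx polyC Q.
  rewrite /char_poly_mx mulmxBr mulmxBl fE !map_mxM; congr (_ - _).
  by rewrite scalar_mxC -mulmxA PQX mulmx1.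
by rewrite !det_mulmx mulrAC -det_mulmx PQX det1 mul1r.
Qed.

(** A spanning list of length equal to the dimension is a basis; in this basis the matrix of [f] is
    diagonal, with the eigenvalues listed in [s] on the diagonal. *)
Lemma is_spectrum_eigenbasis (f : 'End(V)) (s : seq (V * K)) (t : {mset K}%mset) :
    {in s, forall x, f x.1 = x.2 *: x.1} ->
    size s = \dim {:V} -> ({:V} <= <<unzip1 s>>)%VS ->
    \prod_(x <- s) ('X - x.2%:P) = \prod_(a <- t) ('X - a%:P) ->
  is_spectrum f t.
Proof.
move=> fs ss sV st; rewrite /is_spectrum -st.
have s1 : size (unzip1 s) == \dim {:V} by rewrite size_map ss.
pose e := Tuple s1; have eB : basis_of {:V} e by rewrite basisEdim sV (eqP s1) /=.
rewrite (char_poly_mxof_basis _ (vbasisP _) eB).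
have fe (i : 'I_(\dim {:V})) j :
    passmx.mxof e e f i j = (i == j)%:R * (nth (0, 0) s i).2.
  have si : (i < size s)%N by rewrite ss.
  rewrite !mxE /= passmx.vecof_delta /= (nth_map (0, 0)) // fs ?mem_nth //.
  rewrite linearZ /= -(nth_map _ 0 fst) // coord_free ?(basis_free eB) //.
  by rewrite mulrC eq_sym.
rewrite char_poly_trig; last first.
  by apply/is_trig_mxP => i j ij; rewrite fe -val_eqE /= (ltn_eqF ij) mul0r.
rewrite (big_nth (0, 0)) ss big_mkord; apply: eq_bigr => i _.
by rewrite fe eqxx mul1r.
Qed.

End EigenBasis.

(** * The three-dimensional summands: a triangle with signed edges *)

Section SignedTriangle.
Variables (K : fieldType) (V : vectType K) (x y z : V).

(** In this form [congr comb3] reduces a vector identity to three scalar ones, within reach of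
    [ring] and [field]. *)
Definition comb3 (a b c : K) : V := a *: x + b *: y + c *: z.

Lemma comb3D a b c a' b' c' :
  comb3 a b c + comb3 a' b' c' = comb3 (a + a') (b + b') (c + c').
Proof. by rewrite /comb3 !scalerDl addrACA [X in X + _]addrACA. Qed.

Lemma comb3Z d a b c : d *: comb3 a b c = comb3 (d * a) (d * b) (d * c).
Proof. by rewrite /comb3 !scalerDr !scalerA. Qed.

Variables (f : {linear V -> V}) (u v w : K).
Hypotheses (u2 : u ^+ 2 = 1) (v2 : v ^+ 2 = 1) (w2 : w ^+ 2 = 1).
Hypothesis fx : f x = 2%:R^-1 *: (u *: y + v *: z).
Hypothesis fy : f y = 2%:R^-1 *: (u *: x + w *: z).
Hypothesis fz : f z = 2%:R^-1 *: (v *: x + w *: y).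

Lemma linear_comb3 a b c : f (comb3 a b c) =
  comb3 (2%:R^-1 * (u * b + v * c)) (2%:R^-1 * (u * a + w * c))
        (2%:R^-1 * (v * a + w * b)).
Proof.
have fx3 : f x = comb3 0 (2%:R^-1 * u) (2%:R^-1 * v).
  by rewrite fx /comb3 scale0r add0r scalerDr !scalerA.
have fy3 : f y = comb3 (2%:R^-1 * u) 0 (2%:R^-1 * w).
  by rewrite fy /comb3 scale0r addr0 scalerDr !scalerA.
have fz3 : f z = comb3 (2%:R^-1 * v) (2%:R^-1 * w) 0.
  by rewrite fz /comb3 scale0r addr0 scalerDr !scalerA.
rewrite {1}/comb3 !linearD !linearZ /= fx3 fy3 fz3 !comb3Z !comb3D.
by congr comb3; ring.
Qed.

(* The diagonal change of signs is D = diag (1, v w, u w). *)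
Definition triangle_eigen : seq (V * K) :=
  [:: (comb3 1 (v * w) (u * w), u * v * w);
      (comb3 (-1) (v * w) 0, - (u * v * w) / 2%:R);
      (comb3 (-1) 0 (u * w), - (u * v * w) / 2%:R)].

Let signE (a : K) : a ^+ 2 = 1 -> a = 1 \/ a = -1.
Proof. by move/eqP; rewrite sqrf_eq1 => /orP[] /eqP; [left|right]. Qed.

Lemma triangle_eigenP : 2%:R != 0 :> K ->
  {in triangle_eigen, forall p, f p.1 = p.2 *: p.1}.
Proof.
move=> nz2 p; rewrite !inE => /or3P[] /eqP-> /=;
  rewrite linear_comb3 comb3Z; congr comb3;
  case: (signE u2) => ->; case: (signE v2) => ->; case: (signE w2) => ->; by field.
Qed.

(** Up to the change of signs the eigenvectors are (1, 1, 1), (-1, 1, 0) and (-1, 0, 1), whose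
    determinant is 3; inverting it recovers [x], [y], [z]. *)
Lemma span_triangle_eigen (S : {vspace V}) : 3%:R != 0 :> K ->
    {subset unzip1 triangle_eigen <= S} -> [/\ x \in S, y \in S & z \in S].
Proof.
move=> nz3 sS.
have S3 a b c d : d = comb3 (a - b - c) (v * w * (a + b)) (u * w * (a + c)) ->
    d \in S.
  suff -> : comb3 (a - b - c) (v * w * (a + b)) (u * w * (a + c)) =
      a *: comb3 1 (v * w) (u * w) + b *: comb3 (-1) (v * w) 0
      + c *: comb3 (-1) 0 (u * w).
    by move=> ->; do 2?[apply: rpredD]; apply: rpredZ; apply: sS;
       rewrite !inE eqxx ?orbT.
  by rewrite !comb3Z !comb3D; congr comb3; ring.
have e1 : x = comb3 1 0 0 by rewrite /comb3 !scale0r !addr0 scale1r.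
have e2 : y = comb3 0 1 0 by rewrite /comb3 !scale0r addr0 add0r scale1r.
have e3 : z = comb3 0 0 1 by rewrite /comb3 !scale0r !add0r scale1r.
(* The coefficients are the rows of the inverse of the matrix whose rows are the eigenvectors. *)
split; [apply: (S3 3%:R^-1 (- 3%:R^-1) (- 3%:R^-1)); rewrite {1}e1
  |apply: (S3 (v * w / 3%:R) (2%:R * v * w / 3%:R) (- (v * w / 3%:R))); rewrite {1}e2
  |apply: (S3 (u * w / 3%:R) (- (u * w / 3%:R)) (2%:R * u * w / 3%:R)); rewrite {1}e3];
  congr comb3; case: (signE u2) => uE; case: (signE v2) => vE;
  case: (signE w2) => wE; rewrite ?uE ?vE ?wE; by field.
Qed.

Definition triangle_roots (k : K) : seq K := [:: k; - k / 2%:R; - k / 2%:R].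

Lemma unzip2_triangle_eigen : unzip2 triangle_eigen = triangle_roots (u * v * w).
Proof. by []. Qed.

End SignedTriangle.

(** * Products of a block idempotent with the basis vectors *)

Ltac set_perm := by apply/setP => ?; rewrite !inE; do !case: (_ == _).

Lemma cards3E (T : finType) (A : {set T}) : #|A| = 3%N ->
  exists i j k, uniq [:: i; j; k] /\ A = [set i; j; k].
Proof.
rewrite cardE; have := enum_uniq A; case eA: (enum A) => [|i [|j [|k []]]] // u _.
exists i, j, k; split=> //; apply/setP => x.
by rewrite -mem_enum eA !inE orbA.
Qed.

Section Algebra.
Variables (K : fieldType) (m : nat) (delta : decoration m).
Implicit Types (i j k r : 'I_m) (T : {set 'I_m}).

Local Notation mul := (@Defs.mul K m delta).

Lemma mulDl (x y z : incalg K m) : mul (x + y) z = mul x z + mul y z.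
Proof.
rewrite /Defs.mul -big_split; apply: eq_bigr => p _; rewrite -big_split.
by apply: eq_bigr => q _; rewrite ffunE mulrDl scalerDl.
Qed.

Lemma mulZl a (x z : incalg K m) : mul (a *: x) z = a *: mul x z.
Proof.
rewrite /Defs.mul scaler_sumr; apply: eq_bigr => p _; rewrite scaler_sumr.
by apply: eq_bigr => q _; rewrite ffunE scalerA mulrA.
Qed.

(* It is 0 when i = j. *)
Definition pair_elt i j : incalg K m := [ffun p => (val p == [set i; j])%:R].

Lemma pair_eltC i j : pair_elt i j = pair_elt j i.
Proof. by rewrite /pair_elt setUC. Qed.

Lemma pair_eltE i j : i != j ->
  exists2 p : point m, val p = [set i; j] & pair_elt i j = pt_elt K p.
Proof.
move=> ij; have c2 : #|[set i; j]| == 2%N by rewrite cards2 ij.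
exists (Sub [set i; j] c2 : point m); first by [].
by apply/ffunP => q; rewrite !ffunE -val_eqE.
Qed.

Lemma pt_eltE (p : point m) :
  exists i j, [/\ i != j, val p = [set i; j] & pt_elt K p = pair_elt i j].
Proof.
have /cards2P[i [j [ij pE]]] := valP p; exists i, j; split=> //.
by apply/ffunP => q; rewrite !ffunE -val_eqE pE.
Qed.

(* Some block has support T only if #|T| = 3; otherwise the value is 1. *)
Definition set_sign T : K := \prod_(b : block m | supp b == T) dsign K delta b.

Lemma set_signE b T : supp b = T -> set_sign T = dsign K delta b.
Proof.
move=> <-; rewrite /set_sign (big_pred1 b) // => b'.
by rewrite /= (inj_eq (@supp_inj m)).
Qed.

Lemma dsign_sq b : dsign K delta b ^+ 2 = 1.
Proof. by rewrite /dsign; case: (delta b) => s /= /orP[] /eqP->; ring. Qed.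

Lemma set_sign_sq T : set_sign T ^+ 2 = 1.
Proof.
by rewrite /set_sign -prodrXl big1 // => b _; rewrite dsign_sq.
Qed.

Lemma cards3_uniq i j k : uniq [:: i; j; k] -> #|[set i; j; k]| = 3%N.
Proof.
by rewrite -[_ :|: _]setUA !cardsU1 cards1 /= !inE andbT => /andP[-> ->].
Qed.

Lemma mul_pair_elt i j k : uniq [:: i; j; k] ->
  mul (pair_elt i j) (pair_elt i k) = set_sign [set i; j; k] *: pair_elt j k.
Proof.
move=> u; have [b bE] := block_ex (cards3_uniq u).
rewrite (set_signE bE); have := u; rewrite /= !inE negb_or !andbT.
case/andP=> /andP[ij ik] jk.
have [p pE ->] := pair_eltE ij; have [q qE ->] := pair_eltE ik.
by have [r rE ->] := pair_eltE jk; apply: mul_basis bE.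
Qed.

Lemma mul_pair_elt0 i j k r : i != j -> k != r ->
    [set i; j] = [set k; r] \/ [disjoint [set i; j] & [set k; r]] ->
  mul (pair_elt i j) (pair_elt k r) = 0.
Proof.
move=> ij kr; have [p pE ->] := pair_eltE ij; have [q qE ->] := pair_eltE kr.
rewrite -pE -qE => pq; apply: mul_basis0.
by case: pq => [/val_inj|]; [left|right].
Qed.

Lemma block_idemE b i j k : uniq [:: i; j; k] -> supp b = [set i; j; k] ->
  block_idem K delta b = (2%:R^-1 * set_sign (supp b)) *:
    (pair_elt i j + pair_elt i k + pair_elt j k).
Proof.
move=> u bE; rewrite /block_idem (set_signE erefl); congr (_ *: _).
have := u; rewrite /= !inE negb_or !andbT; case/andP=> /andP[ij ik] jk.
have [p pE ->] := pair_eltE ij; have [q qE ->] := pair_eltE ik.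
have [r rE ->] := pair_eltE jk.
have u3 : uniq [:: p; q; r].
  have D x (s t : point m) : (x \in val s) != (x \in val t) -> s != t.
    by apply: contraNneq => ->.
  rewrite /= !inE negb_or andbT; apply/andP; split; first (apply/andP; split).
  - by apply: (D j); rewrite pE qE !inE eqxx orbT eq_sym (eq_sym j) (negPf ij) (negPf jk).
  - by apply: (D i); rewrite pE rE !inE eqxx (negPf ij) (negPf ik).
  - by apply: (D i); rewrite qE rE !inE eqxx (negPf ij) (negPf ik).
have bpE : val b = [set p; q; r].
  apply/esym/eqP; rewrite eqEcard card_block.
  have -> : #|[set p; q; r]| = 3%N.
    rewrite -[_ :|: _]setUA !cardsU1 cards1 !inE.
    by have := u3; rewrite /= !inE andbT => /andP[-> ->].
  rewrite andbT !subUset !sub1set !mem_block bE pE qE rE.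
  by rewrite !subUset !sub1set !inE !eqxx !orbT.
rewrite (eq_bigl [in [:: p; q; r]]) => [|s]; last by rewrite bpE !inE orbA.
rewrite -big_uniq // !big_cons big_nil /= -addrA.
by congr (_ + (_ + _)); apply: addr0.
Qed.

(** Both nonzero products carry the sign of [b], which cancels against the sign in the idempotent.
    The coefficients [1 *:] match the form of the hypotheses on a signed triangle with u = v = w =
    1. *)
Lemma mul_idem_in b i j k : uniq [:: i; j; k] -> supp b = [set i; j; k] ->
  mul (block_idem K delta b) (pair_elt i j) =
    2%:R^-1 *: (1 *: pair_elt i k + 1 *: pair_elt j k).
Proof.
move=> u bE; rewrite (block_idemE u bE) mulZl !mulDl.
have := u; rewrite /= !inE negb_or !andbT; case/andP=> /andP[ij ik] jk.
rewrite mul_pair_elt0 //; last by left.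
rewrite mul_pair_elt; last by rewrite /= !inE negb_or ik ij eq_sym jk.
rewrite (pair_eltC i j) mul_pair_elt; last first.
  by rewrite /= !inE negb_or jk -!(eq_sym i) ij ik.
have -> : [set i; k; j] = supp b by rewrite bE; set_perm.
have -> : [set j; k; i] = supp b by rewrite bE; set_perm.
rewrite add0r -scalerDr scalerA -mulrA -expr2 set_sign_sq mulr1 !scale1r addrC.
by rewrite (pair_eltC k i) (pair_eltC k j).
Qed.

(** Of ij, ik, jk only jk is disjoint from ir; the other two send e_ir to e_jr and e_kr. This is one
    row of the signed triangle at r, and permuting i, j, k gives the other two. *)
Lemma mul_idem_out b i j k r : uniq [:: i; j; k; r] -> supp b = [set i; j; k] ->
  mul (block_idem K delta b) (pair_elt i r) =
    2%:R^-1 *: ((set_sign (supp b) * set_sign [set i; j; r]) *: pair_elt j r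
                + (set_sign (supp b) * set_sign [set i; k; r]) *: pair_elt k r).
Proof.
move=> u bE; have := u; rewrite /= !inE !negb_or !andbT.
case/and3P=> /and3P[ij ik ir] /andP[jk jr] kr.
have u3 : uniq [:: i; j; k] by rewrite /= !inE negb_or ij ik jk.
rewrite (block_idemE u3 bE) mulZl !mulDl.
rewrite !mul_pair_elt ?/= ?inE ?negb_or ?ij ?ik ?ir ?jr ?kr //.
rewrite mul_pair_elt0 ?addr0 //; last first.
  right; rewrite disjoints_subset subUset !sub1set !inE !negb_or.
  by rewrite jr kr -!(eq_sym i) ij ik.
by rewrite -!scalerA -!scalerDr !scalerA.
Qed.

Lemma mul_idem_disjoint b i j : i != j -> i \notin supp b -> j \notin supp b ->
  mul (block_idem K delta b) (pair_elt i j) = 0.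
Proof.
move=> ij ib jb; have [u [v [w [uvw bE]]]] := cards3E (blockP b).1.
rewrite (block_idemE uvw bE) mulZl !mulDl.
have := uvw; rewrite /= !inE negb_or !andbT; case/andP=> /andP[uv uw] vw.
have out x y : x != y -> x \in supp b -> y \in supp b ->
    mul (pair_elt x y) (pair_elt i j) = 0.
  move=> xy xb yb; apply: mul_pair_elt0 => //; right.
  have D s t : s \in supp b -> t \notin supp b -> s != t.
    by move=> sb; apply: contraNneq => <-.
  by rewrite disjoints_subset subUset !sub1set !inE !negb_or !D.
by rewrite !out ?addr0 ?scaler0 // bE !inE eqxx ?orbT.
Qed.

End Algebra.

(** * The sign [kappa] of a summand, and cardinalities *)

Lemma uniq3_setC m (b : block m) (i j k r : 'I_m) :
    uniq [:: i; j; k] -> supp b = [set i; j; k] -> r \notin supp b ->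
  uniq [:: i; j; k; r].
Proof.
move=> u bE; rewrite bE !inE !negb_or => /andP[/andP[ri rj] rk].
move: u; rewrite /= !inE !negb_or !andbT => /andP[/andP[-> ->] ->].
by rewrite -!(eq_sym r) ri rj rk.
Qed.

Lemma blocks_through m (i j k r : 'I_m) : uniq [:: i; j; k; r] ->
  exists b1 b2 b3 : block m,
    [/\ supp b1 = [set i; j; r], supp b2 = [set i; k; r] & supp b3 = [set j; k; r]].
Proof.
rewrite /= !inE !negb_or !andbT => /and3P[/and3P[ij ik ir] /andP[jk jr] kr].
have ex x y : uniq [:: x; y; r] -> exists b : block m, supp b = [set x; y; r].
  by move=> u; apply/block_ex/cards3_uniq.
have [b1 E1] : exists b : block m, supp b = [set i; j; r].
  by apply: ex; rewrite /= !inE negb_or ij ir jr.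
have [b2 E2] : exists b : block m, supp b = [set i; k; r].
  by apply: ex; rewrite /= !inE negb_or ik ir kr.
have [b3 E3] : exists b : block m, supp b = [set j; k; r].
  by apply: ex; rewrite /= !inE negb_or jk jr kr.
by exists b1, b2, b3.
Qed.

(** The left side is the product u v w for the signed triangle at r. The sign of [b] occurs in it
    three times, and its cube is itself. *)
Lemma kappa_set_sign (K : fieldType) m (delta : decoration m) (b : block m)
    (i j k r : 'I_m) :
    uniq [:: i; j; k] -> supp b = [set i; j; k] -> r \notin supp b ->
  set_sign K delta (supp b) * set_sign K delta [set i; j; r] *
    (set_sign K delta (supp b) * set_sign K delta [set i; k; r]) *
    (set_sign K delta (supp b) * set_sign K delta [set j; k; r]) =
  (kappa delta (r |: supp b))%:~R.
Proof.
move=> u bE rb; have u4 := uniq3_setC u bE rb.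
have [b1 [b2 [b3 [E1 E2 E3]]]] := blocks_through u4.
have -> : r |: supp b = [set i; j; k; r] by rewrite bE setUC.
rewrite (kappaE delta u4 bE E1 E2 E3) !rmorphM /=.
rewrite (set_signE K delta erefl) (set_signE K delta E1) (set_signE K delta E2).
rewrite (set_signE K delta E3) -/(dsign K delta b) -/(dsign K delta b1).
rewrite -/(dsign K delta b2) -/(dsign K delta b3).
by ring: (dsign_sq K delta b).
Qed.

Lemma kappa_sign m (delta : decoration m) (Q : {set 'I_m}) :
  kappa delta Q = 1 \/ kappa delta Q = -1.
Proof.
rewrite /kappa; elim/big_ind: _ => [|x y|b _]; first by left.
  by case=> ->; case=> ->; rewrite ?mul1r ?mulr1 ?mulrNN; [left|right|right|left].
by case: (delta b) => s /= /orP[] /eqP->; [left|right].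
Qed.

Lemma card_supp_setC m (b : block m) : #|~: supp b| = (m - 3)%N.
Proof. by rewrite cardsCs setCK card_ord (blockP b).1. Qed.

Lemma n_neg_le m (delta : decoration m) (b : block m) : (n_neg delta b <= m - 3)%N.
Proof.
rewrite -(card_supp_setC b); apply/subset_leq_card/subsetP => r.
by rewrite inE => /andP[].
Qed.

Lemma card_point m : #|{: point m}| = 'C(m, 2).
Proof.
rewrite card_sig -[m in RHS]card_ord -card_draws cardsE.
by apply: eq_card => A; rewrite !inE.
Qed.

(** These points index the basis vectors killed by the idempotent of [b], so this counts the zero
    eigenvalues they contribute. *)
Lemma card_disjoint_points m (b : block m) :
  #|[set p : point m | [disjoint val p & supp b]]| = 'C(m - 3, 2).
Proof.
rewrite -(card_supp_setC b) -cards_draws -(card_imset _ val_inj).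
congr #|pred_of_set _|; apply/setP => A.
apply/imsetP/setIdP => [[p + ->]|[Ab A2]].
  by rewrite inE disjoints_subset => pb; split => //; apply: (valP p).
by exists (Sub A A2 : point m); rewrite ?inE // disjoints_subset.
Qed.

(** * The spectrum of a block idempotent *)

Lemma sum_pt_elt (K : fieldType) m (x : incalg K m) : x = \sum_p x p *: pt_elt K p.
Proof.
apply/ffunP => q; rewrite sum_ffunE (bigD1 q) //= [X in _ = X + _]ffunE.
rewrite ffunE eqxx [_ *: _]mulr1.
rewrite big1 ?addr0 // => p /negPf pq.
by rewrite !ffunE eq_sym pq; apply: mulr0.
Qed.

(** In order: the summand of the block itself, the [n] summands with [kappa] = -1, those with
    [kappa] = 1, and the killed basis vectors. The truncated subtraction is exact for n <= m - 3,
    which [n_neg_le] guarantees. *)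
Definition spectrum_seq (K : fieldType) (m n : nat) : seq K :=
  triangle_roots 1 ++ flatten (nseq n (triangle_roots (-1)))
  ++ flatten (nseq (m - 3 - n) (triangle_roots 1)) ++ nseq 'C(m - 3, 2) 0.

Lemma block_idem_spectrum (K : fieldType) m (delta : decoration m) (b : block m) :
    2%:R != 0 :> K -> 3%:R != 0 :> K ->
  is_spectrum (lmul delta (block_idem K delta b))
    (seq_mset (spectrum_seq K m (n_neg delta b))).
Proof.
move=> nz2 nz3; have m3 : (3 <= m)%N.
  by rewrite -(blockP b).1 -[m in leqRHS]card_ord max_card.
have [i [j [k [u bE]]]] := cards3E (blockP b).1.
have := u; rewrite /= !inE negb_or !andbT; case/andP=> /andP[ij ik] jk.
pose e := @pair_elt K m; pose d := set_sign K delta.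
pose s1 := triangle_eigen (e i j) (e i k) (e j k) 1 1 1.
pose s2 r := triangle_eigen (e i r) (e j r) (e k r) (d (supp b) * d [set i; j; r])
  (d (supp b) * d [set i; k; r]) (d (supp b) * d [set j; k; r]).
pose s3 := [seq (pt_elt K p, 0 : K) |
  p <- enum [set p : point m | [disjoint val p & supp b]]].
pose s := s1 ++ flatten [seq s2 r | r <- enum (~: supp b)] ++ s3.
have d2 T T' : (d T * d T') ^+ 2 = 1 by rewrite exprMn !set_sign_sq mulr1.
apply: (@is_spectrum_eigenbasis _ _ _ s).
- move=> p; rewrite lfunE !mem_cat => /or3P[|/flatten_mapP[r]|/mapP[q]].
  + apply: triangle_eigenP; rewrite ?expr1n //.
    * exact: mul_idem_in.
    (* The images of e_ik and e_jk come from the same formula with i, j, k permuted. *)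
    * rewrite /e (pair_eltC _ j k); apply: mul_idem_in; last by rewrite bE; set_perm.
      by rewrite /= !inE negb_or ik ij eq_sym jk.
    * rewrite /e (pair_eltC _ i j) (pair_eltC _ i k).
      apply: mul_idem_in; last by rewrite bE; set_perm.
      by rewrite /= !inE negb_or jk -!(eq_sym i) ij ik.
  + rewrite mem_enum inE => rb; have u4 := uniq3_setC u bE rb.
    have P : uniq [:: j; i; k; r] /\ uniq [:: k; i; j; r].
      move: u4; rewrite /= !inE !negb_or !andbT !(eq_sym j i) !(eq_sym k i) (eq_sym k j).
      by case/and3P => /and3P[-> -> ->] /andP[-> ->] ->.
    apply: triangle_eigenP => //=.
    * exact: mul_idem_out.
    * rewrite /d [[set i; j]]setUC; apply: mul_idem_out P.1 _.
      by rewrite bE; set_perm.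
    * rewrite /d [[set i; k]]setUC [[set j; k]]setUC; apply: mul_idem_out P.2 _.
      by rewrite bE; set_perm.
  + rewrite mem_enum inE => qb -> /=; rewrite scale0r.
    have [x [y [xy qE ->]]] := pt_eltE K q.
    move: qb; rewrite qE disjoints_subset subUset !sub1set !inE => /andP[xb yb].
    exact: mul_idem_disjoint.
- have -> : \dim {:incalg K m} = (#|{: point m}| * 1)%N by rewrite dimvf.
  rewrite card_point !size_cat size_map -cardE card_disjoint_points.
  rewrite size_flatten /shape -map_comp sumnE big_map.
  rewrite (eq_bigr (fun=> 3%N)) // big_enum sum_nat_const card_supp_setC /=.
  (* With m = m2 + 3, Pascal's rule makes 3 + 3 (m - 3) + C(m - 3, 2) = C(m, 2) linear. *)
  by case: (m) m3 => [|[|[|m2]]] //= _; rewrite !subSS subn0 !binS !bin0 bin1; lia.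
- set S := <<_>>%VS.
  have sS x : x \in unzip1 s -> x \in S by apply: memv_span.
  have [Sij Sik Sjk] : [/\ e i j \in S, e i k \in S & e j k \in S].
    apply: (@span_triangle_eigen _ _ _ _ _ 1 1 1); rewrite ?expr1n // => x xs.
    by apply: sS; rewrite /s /unzip1 map_cat mem_cat xs.
  have SC x y : e x y \in S -> e y x \in S by rewrite /e pair_eltC.
  have Sin x y : x != y -> x \in supp b -> y \in supp b -> e x y \in S.
    rewrite bE !inE -!orbA => xy /or3P[] /eqP xE /or3P[] /eqP yE;
      move: xy; rewrite xE yE ?eqxx // => _; do [done | exact: SC].
  have Sout x y : x \in supp b -> y \notin supp b -> e x y \in S.
    move=> xb yb; have [Si Sj Sk] : [/\ e i y \in S, e j y \in S & e k y \in S].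
      apply: (@span_triangle_eigen _ _ _ _ _ (d (supp b) * d [set i; j; y])
        (d (supp b) * d [set i; k; y]) (d (supp b) * d [set j; k; y])) => //.
      move=> w /mapP[q qs ->]; apply/sS/map_f; rewrite !mem_cat; apply/or3P/Or32.
      by apply/flatten_mapP; exists y; rewrite // mem_enum inE.
    by move: xb; rewrite bE !inE -orbA => /or3P[] /eqP->.
  apply/subvP => x _; rewrite (sum_pt_elt x); apply: rpred_sum => p _; apply: rpredZ.
  have [y [z [yz pE pyz]]] := pt_eltE K p.
  (* A point has two, one or no elements in the support of [b]; these cases match the families [s1],
     [s2] and [s3]. *)
  have [yb|yb] := boolP (y \in supp b); have [zb|zb] := boolP (z \in supp b).
  + by rewrite pyz; apply: Sin.
  + by rewrite pyz; apply: Sout.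
  + by rewrite pyz; apply/SC/Sout.
  apply: sS; rewrite /s /unzip1 !map_cat !mem_cat -map_comp map_f ?orbT //.
  by rewrite mem_enum inE pE disjoints_subset subUset !sub1set !inE yb zb.
(* [q k] is the factor contributed by a triangle with u v w = k; it depends on the signs only
   through [k]. *)
pose q (k : K) := \prod_(a <- triangle_roots k) ('X - a%:P).
have qE (x y z : incalg K m) (t v w : K) :
    \prod_(p <- triangle_eigen x y z t v w) ('X - p.2%:P) = q (t * v * w).
  by rewrite /q -(unzip2_triangle_eigen x y z) big_map.
pose R := ~: supp b; pose neg r := kappa delta (r |: supp b) == -1.
have -> : \prod_(x <- s) ('X - x.2%:P) =
    q 1 * (\prod_(r in R) q (kappa delta (r |: supp b))%:~R * 'X^('C(m - 3, 2))).
  rewrite /s !big_cat /=; congr (_ * (_ * _)).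
  - by rewrite qE !mulr1.
  - rewrite big_flatten big_map big_enum; apply: eq_bigr => r; rewrite inE => rb.
    by rewrite -(kappa_set_sign K delta u bE rb) qE.
  by rewrite big_map big_enum /= subr0 prodr_const card_disjoint_points.
rewrite (perm_big _ (perm_eq_seq_mset _)) /spectrum_seq !big_cat /=; congr (_ * _).
rewrite mulrA; congr (_ * _); last first.
  by rewrite big_nseq subr0 iter_mulr_1.
rewrite !big_flatten !big_nseq !iter_mulr_1.
have cN : #|[set r in R | neg r]| = n_neg delta b by [].
have cP : #|[set r in R | ~~ neg r]| = (m - 3 - n_neg delta b)%N.
  rewrite -(card_supp_setC b) -/R -(cardsID [set r | neg r] R) -cN.
  have -> : R :&: [set r | neg r] = [set r in R | neg r] by apply/setP=> r; rewrite !inE.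
  by rewrite addKn; apply: eq_card => r; rewrite !inE andbC.
(* As [kappa] is 1 or -1, splitting by [neg] leaves only powers of [q (-1)] and [q 1], with
   exponents given by [cN] and [cP]. *)
rewrite (bigID neg) /= -cP -[in RHS]cN; congr (_ * _).
  rewrite (eq_bigr (fun=> q (-1))) => [|r /andP[_ /eqP->]]; last by rewrite rmorphN1.
  by rewrite -prodr_const; apply: eq_bigl => r; rewrite inE.
rewrite (eq_bigr (fun=> q 1)) => [|r /andP[_]]; last first.
  by rewrite /neg; case: (kappa_sign delta (r |: supp b)) => ->.
by rewrite -prodr_const; apply: eq_bigl => r; rewrite inE.
Qed.

(** * Decorations realizing every admissible value *)

Lemma n_neg_onto m (b : block m) (n : nat) : (n <= m - 3)%N ->
  exists delta : decoration m, n_neg delta b = n.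
Proof.
(* A set [A] of [n] elements outside the support exists because C(m - 3, n) is positive. *)
move=> nm; have [A] :
    exists A, A \in [set A : {set 'I_m} | A \subset ~: supp b & #|A| == n].
  by apply/card_gt0P; rewrite cards_draws card_supp_setC bin_gt0.
rewrite inE => /andP[/subsetP Ab /eqP <-].
have [i [j [k [u bE]]]] := cards3E (blockP b).1.
have s1 : (1 == 1 :> int) || (1 == -1 :> int) by [].
have sN1 : (-1 == 1 :> int) || (-1 == -1 :> int) by [].
pose delta : decoration m := fun c =>
  if (i \notin supp c) && ~~ [disjoint supp c & A]
  then (exist _ (-1) sN1 : sign) else (exist _ 1 s1 : sign).
have pos c : i \in supp c -> val (delta c) = 1 by rewrite /delta => ->.
exists delta; apply: eq_card => r; rewrite !inE.
have [rA|rA] := boolP (r \in supp b) => /=.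
  by apply/esym/negP => /Ab; rewrite inE rA.
have u4 := uniq3_setC u bE rA.
have := u4; rewrite /= !inE !negb_or => /andP[/and3P[ij ik ir] _].
have [b1 [b2 [b3 [E1 E2 E3]]]] := blocks_through u4.
rewrite {1}bE setUC (kappaE delta u4 bE E1 E2 E3).
rewrite (pos b) ?(pos b1) ?(pos b2) ?bE ?E1 ?E2 ?inE ?eqxx // !mul1r /delta E3.
have -> : i \notin [set j; k; r] by rewrite !inE !negb_or ij ik ir.
have nA x : x \in supp b -> x \notin A by move=> xb; apply/negP => /Ab; rewrite inE xb.
(* Since j and k lie in the support of [b], they avoid [A]; thus b_jkr meets [A] exactly when r is
   in [A], and the set being counted is [A]. *)
have -> : [disjoint [set j; k; r] & A] = (r \notin A).
  by rewrite disjoints_subset !subUset !sub1set !inE (nA j) ?(nA k) // bE !inE eqxx ?orbT.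
by rewrite negbK; case: (r \in A).
Qed.

Theorem corollary2p9 (K : fieldType) (m : nat)
    (charK : [pchar K] =i pred0) (hm : (3 <= m)%N) :
  [/\ exists spec : nat -> {mset K}%mset,
        forall (delta : decoration m) (b : block m),
          is_spectrum (lmul delta (block_idem K delta b)) (spec (n_neg delta b)),
      forall (delta : decoration m) (b : block m),
        (0 <= n_neg delta b <= m - 3)%N
    & forall (b : block m) (n : nat), (0 <= n <= m - 3)%N ->
        exists delta : decoration m, n_neg delta b = n].
Proof.
split=> [|delta b|b n /andP[_]]; [|exact: n_neg_le|exact: n_neg_onto].
(* The witness involves neither [delta] nor [b], so the spectrum depends on them only through
   [n_neg]. *)
exists (fun n => seq_mset (spectrum_seq K m n)) => delta b.
(* Characteristic 0 makes 2 and 3 nonzero in [K]. *)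
by apply: block_idem_spectrum; rewrite ((pcharf0P K).1 charK).
Qed.
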